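(* Let $p\in(0,1)$, $q=1-p$, and let $x$ be a real number with $0\le x\le q$. Then $$\frac{x^2}{2\left(pq+\frac{x(q-p)}{3}\right)}\;\le\;D(p+x\,\|\,p)\;\le\;\frac{x^2}{2\left(pq-\frac{xp}{2}\right)}\;\le\;\frac{x^2}{pq}.$$
   Context: For $a\in[0,1]$ and $p\in(0,1)$, $D(a\,\|\,p)=a\ln\frac{a}{p}+(1-a)\ln\frac{1-a}{1-p}$ denotes the Kullback–Leibler divergence between the Bernoulli distributions of parameters $a$ and $p$, with the convention $0\ln 0=0$. *)

(* Defs.v *)
From Stdlib Require Export Reals.

Local Open Scope R_scope.

(* The Kullback-Leibler divergence of Bernoulli(a) from Bernoulli(p), meant for
   0 <= a <= 1 and 0 < p < 1.  The convention 0 ln 0 = 0 holds automatically: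
   at a = 0 (resp. a = 1) the first (resp. second) summand is 0 times a real
   number, because Stdlib's ln is total. *)
Definition bernoulli_KL (a p : R) : R :=
  a * ln (a / p) + (1 - a) * ln ((1 - a) / (1 - p)).

(* Main.v *)
(* Upper bound: in D(p+x||p) = (p+x) ln (1+x/p) + (q-x) ln (1-x/q), bound the
   logarithms by ln y <= (y^2-1)/(2y) for y >= 1 and ln y <= 2(y-1)/(y+1) for
   y <= 1; what remains is a rational inequality that reduces to x >= 0.

   Lower bound: with a = pq and b = (q-p)/3, the left-hand side
   x^2/(2(a+bx)) and D(p+x||p) vanish to second order at x = 0, and their second
   derivatives a^2/(a+bx)^3 and 1/(a+3bx-x^2) are ordered because
   (a+bx)^3 - a^2(a+3bx-x^2) = x^2 (b^2(a+bx) + 2ab^2 + a^2).  Since D is not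
   differentiable at x = q, that endpoint is treated separately. *)
Require Import Defs.
From Stdlib Require Import Reals.
From Stdlib Require Import Lra.
From Coquelicot Require Import Coquelicot.
Open Scope R_scope.

Lemma le_of_derive_nonneg (f f' : R -> R) (a b : R) :
  a <= b ->
  (forall t, a <= t <= b -> is_derive f t (f' t)) ->
  (forall t, a <= t <= b -> 0 <= f' t) ->
  f a <= f b.
Proof.
  intros hab hd hpos.
  destruct (Req_dec a b) as [->|hne]; [lra|].
  destruct (MVT_cor2 f f' a b) as [c [hc hcab]]; [lra| |].
  - intros c hc. apply is_derive_Reals, hd, hc.
  - assert (0 <= f' c) by (apply hpos; lra). nra.
Qed.

(** The difference of the two sides is nondecreasing on [(0, 1]], its derivative being a square over
    a positive quantity, and vanishes at [1]. *)
Lemma ln_le_pade (y : R) : 0 < y <= 1 -> ln y <= 2 * (y - 1) / (y + 1).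
Proof.
  intros hy.
  assert (h : ln y - 2 * (y - 1) / (y + 1) <= ln 1 - 2 * (1 - 1) / (1 + 1)).
  { apply (le_of_derive_nonneg (fun t => ln t - 2 * (t - 1) / (t + 1))
             (fun t => (t - 1) ^ 2 / (t * (t + 1) ^ 2))); [lra| |].
    - intros t ht. auto_derive; [lra|]. field; lra.
    - intros t ht. apply Rdiv_le_0_compat; [apply pow2_ge_0|].
      apply Rmult_lt_0_compat; [lra|apply pow_lt; lra]. }
  rewrite ln_1 in h. lra.
Qed.

Lemma ln_le_half_diff_inv (y : R) : 1 <= y -> ln y <= (y ^ 2 - 1) / (2 * y).
Proof.
  intros hy.
  assert (h : (1 ^ 2 - 1) / (2 * 1) - ln 1 <= (y ^ 2 - 1) / (2 * y) - ln y).
  { apply (le_of_derive_nonneg (fun t => (t ^ 2 - 1) / (2 * t) - ln t)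
             (fun t => (t - 1) ^ 2 / (2 * t ^ 2))); [lra| |].
    - intros t ht. auto_derive; [lra|]. field; lra.
    - intros t ht. apply Rdiv_le_0_compat; [apply pow2_ge_0|].
      assert (0 < t ^ 2) by (apply pow_lt; lra). lra. }
  rewrite ln_1 in h. lra.
Qed.

Lemma bernoulli_KL_shift (p q x : R) :
  q = 1 - p ->
  bernoulli_KL (p + x) p = (p + x) * ln ((p + x) / p) + (q - x) * ln ((q - x) / q).
Proof.
  intros ->. unfold bernoulli_KL.
  now replace (1 - (p + x)) with (1 - p - x) by ring.
Qed.

Lemma bernoulli_KL_upper (p q x : R) :
  0 < p < 1 -> q = 1 - p -> 0 <= x <= q ->
  bernoulli_KL (p + x) p <= x ^ 2 / (2 * (p * q - x * p / 2)).
Proof.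
  intros hp hq hx. rewrite (bernoulli_KL_shift p q x hq).
  assert (h1 : (p + x) * ln ((p + x) / p) <= x * (2 * p + x) / (2 * p)).
  { replace (x * (2 * p + x) / (2 * p))
      with ((p + x) * ((((p + x) / p) ^ 2 - 1) / (2 * ((p + x) / p))))
      by (field; lra).
    apply Rmult_le_compat_l; [lra|]. apply ln_le_half_diff_inv.
    apply Rle_div_r; lra. }
  assert (h2 : (q - x) * ln ((q - x) / q) <= (q - x) * (- 2 * x / (2 * q - x))).
  (* At [x = q] the logarithm has argument [0], outside the range of [ln_le_pade], but the factor
     [q - x] makes both sides zero. *)
  { destruct (Req_dec x q) as [->|hne].
    - rewrite Rminus_diag. lra.
    - replace (- 2 * x / (2 * q - x))
        with (2 * ((q - x) / q - 1) / ((q - x) / q + 1)) by (field; lra).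
      apply Rmult_le_compat_l; [lra|]. apply ln_le_pade. split.
      + apply Rdiv_lt_0_compat; lra.
      + apply Rle_div_l; lra. }
  (* The exact slack left by the two logarithm bounds; the identity relies on [p + q = 1]. *)
  assert (h3 : x ^ 2 / (2 * (p * q - x * p / 2))
               - (x * (2 * p + x) / (2 * p) + (q - x) * (- 2 * x / (2 * q - x)))
               = x ^ 3 / (2 * p * (2 * q - x))).
  { subst q. field. repeat split; nra. }
  assert (0 <= x ^ 3 / (2 * p * (2 * q - x))).
  { apply Rdiv_le_0_compat.
    - apply pow_le; lra.
    - apply Rmult_lt_0_compat; lra. }
  lra.
Qed.

(** The expression is affine in [x], with values [p * q] at [0] and [q * (1 + p) / 3] at [q], both
    positive. *)
Lemma bernstein_denominator_pos (p q x : R) :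
  0 < p < 1 -> q = 1 - p -> 0 <= x <= q -> 0 < p * q + x * (q - p) / 3.
Proof. intros hp hq hx. nra. Qed.

(** Here the divergence is [- ln p], which [ln_le_pade] bounds below by [2 * q / (1 + p)], while the
    left-hand side simplifies to [3 * q / (2 * (1 + p))]. *)
Lemma bernoulli_KL_lower_endpoint (p q : R) :
  0 < p < 1 -> q = 1 - p ->
  q ^ 2 / (2 * (p * q + q * (q - p) / 3)) <= bernoulli_KL (p + q) p.
Proof.
  intros hp hq. rewrite (bernoulli_KL_shift p q q hq), Rminus_diag.
  replace (p + q) with 1 by lra.
  replace (1 / p) with (/ p) by (field; lra). rewrite ln_Rinv by lra.
  assert (h := ln_le_pade p ltac:(lra)).
  assert (h1 : q ^ 2 / (2 * (p * q + q * (q - p) / 3))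
               = - (2 * (p - 1) / (p + 1)) - (1 - p) / (2 * (p + 1))).
  { subst q. field. repeat split; nra. }
  assert (0 <= (1 - p) / (2 * (p + 1))) by (apply Rdiv_le_0_compat; lra).
  lra.
Qed.

Lemma bernstein_second_derivative_le (p q x : R) :
  0 < p < 1 -> q = 1 - p -> 0 <= x < q ->
  (p * q) ^ 2 / (p * q + x * (q - p) / 3) ^ 3 <= 1 / ((p + x) * (q - x)).
Proof.
  intros hp hq hx.
  assert (hd := bernstein_denominator_pos p q x hp hq ltac:(lra)).
  assert (ha : 0 < p * q) by (apply Rmult_lt_0_compat; lra).
  assert (hv : 0 < (p + x) * (q - x)) by (apply Rmult_lt_0_compat; lra).
  apply Rle_div_l; [now apply pow_lt|].
  replace (1 / ((p + x) * (q - x)) * (p * q + x * (q - p) / 3) ^ 3)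
    with ((p * q + x * (q - p) / 3) ^ 3 / ((p + x) * (q - x))) by (field; lra).
  apply (proj1 (Rle_div_r _ _ ((p + x) * (q - x)) hv)).
  replace ((p + x) * (q - x)) with (p * q + 3 * (x * ((q - p) / 3)) - x ^ 2)
    by (subst q; field).
  replace (x * (q - p) / 3) with (x * ((q - p) / 3)) in * by field.
  set (a := p * q) in *. set (b := (q - p) / 3) in *.
  (* Since [b] is negative for [p > 1/2], the terms are grouped so that it occurs only in [b ^ 2]
     and in the positive [a + x * b]. *)
  assert (0 <= x ^ 2 * (b ^ 2 * (a + x * b) + 2 * (a * b ^ 2) + a ^ 2)).
  { assert (0 <= b ^ 2) by apply pow2_ge_0.
    assert (0 <= a ^ 2) by apply pow2_ge_0.
    apply Rmult_le_pos; [apply pow2_ge_0|]. nra. }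
  nra.
Qed.

Lemma bernoulli_KL_lower_interior (p q x : R) :
  0 < p < 1 -> q = 1 - p -> 0 <= x < q ->
  x ^ 2 / (2 * (p * q + x * (q - p) / 3)) <= bernoulli_KL (p + x) p.
Proof.
  intros hp hq hx. rewrite (bernoulli_KL_shift p q x hq).
  assert (hd : forall t, 0 <= t < q -> 0 < p * q + t * (q - p) / 3).
  { intros t ht. apply bernstein_denominator_pos; lra. }
  assert (hr : forall t, 0 <= t < q -> 0 < (p + t) / p /\ 0 < (q - t) / q).
  { intros t ht. split; apply Rdiv_lt_0_compat; lra. }
  set (D := fun t => (p + t) * ln ((p + t) / p) + (q - t) * ln ((q - t) / q)).
  set (L := fun t => t ^ 2 / (2 * (p * q + t * (q - p) / 3))).
  set (D' := fun t => ln ((p + t) / p) - ln ((q - t) / q)).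
  set (L' := fun t => (2 * (p * q) * t + (q - p) / 3 * t ^ 2)
                      / (2 * (p * q + t * (q - p) / 3) ^ 2)).
  assert (ln0 : ln ((p + 0) / p) = 0 /\ ln ((q - 0) / q) = 0).
  { split; (etransitivity; [|apply ln_1]); f_equal; field; lra. }
  (* First integration: [D' - L'] vanishes at [0], and its derivative is nonnegative on [[0, s]],
     where [s < q] keeps both logarithms differentiable. *)
  assert (h1 : forall s, 0 <= s < q -> 0 <= D' s - L' s).
  { intros s hs.
    replace 0 with (D' 0 - L' 0).
    2: { unfold D', L'. destruct ln0 as [-> ->]. field. nra. }
    apply (le_of_derive_nonneg (fun t => D' t - L' t)
             (fun t => 1 / ((p + t) * (q - t))
                       - (p * q) ^ 2 / (p * q + t * (q - p) / 3) ^ 3)); [lra| |].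
    - intros t ht. specialize (hd t ltac:(lra)).
      destruct (hr t ltac:(lra)) as [hr1 hr2].
      unfold D', L'. auto_derive.
      + unfold Rdiv, Rminus in *. repeat split; trivial. nra.
      + subst q. field. repeat split; nra.
    - intros t ht.
      assert (h := bernstein_second_derivative_le p q t hp hq ltac:(lra)). lra. }
  (* Second integration, from [D 0 = L 0 = 0]. *)
  assert (h2 : 0 <= D x - L x).
  { replace 0 with (D 0 - L 0).
    2: { unfold D, L. destruct ln0 as [-> ->]. field. nra. }
    apply (le_of_derive_nonneg (fun t => D t - L t) (fun t => D' t - L' t)); [lra| |].
    - intros t ht. specialize (hd t ltac:(lra)).
      destruct (hr t ltac:(lra)) as [hr1 hr2].
      unfold D, L, D', L'. auto_derive.
      + unfold Rdiv, Rminus in *. repeat split; trivial. nra.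
      + unfold Rdiv, Rminus. field. repeat split; nra.
    - intros t ht. apply h1. lra. }
  unfold D, L in h2. lra.
Qed.

Theorem proposition4 (p q x : R) (hp : 0 < p < 1) (hq : q = 1 - p)
    (hx : 0 <= x <= q) :
  x ^ 2 / (2 * (p * q + x * (q - p) / 3)) <= bernoulli_KL (p + x) p /\
  bernoulli_KL (p + x) p <= x ^ 2 / (2 * (p * q - x * p / 2)) /\
  x ^ 2 / (2 * (p * q - x * p / 2)) <= x ^ 2 / (p * q).
Proof.
  split; [|split].
  - destruct (Req_dec x q) as [->|hne].
    + now apply bernoulli_KL_lower_endpoint.
    + apply bernoulli_KL_lower_interior; lra.
  - now apply bernoulli_KL_upper.
  (* The denominators compare because [x <= q] gives [2 * p * q - x * p >= p * q]. *)
  - apply Rmult_le_compat_l; [apply pow2_ge_0|].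
    apply Rinv_le_contravar; nra.
Qed.
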